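(* Let $\{\mathcal{H};\mathcal{E}=\{\mathcal{H}_\iota\}_{\iota\in\Omega};\mathcal{D}_{\mathcal{E}}\}$ be a commutative quantized domain with $\mathcal{E}$ upward filtered and such that $C^*(\mathcal{D}_{\mathcal{E}})$ is an injective local operator space, and let $\mathcal{V}\subseteq C^*(\mathcal{D}_{\mathcal{E}})$ be a unital local operator space. Then the local $\mathcal{R}$-$C^*$-envelope of $\mathcal{V}$ is unique up to a unital local isometric $\mathcal{R}$-$*$-isomorphism.
   Context: Locally $C^*$-algebras: a $C^*$-seminorm on a unital $*$-algebra is a seminorm $p$ with $p(1)=1$, $p(ab)\le p(a)p(b)$, $p(a^* )=p(a)$, $p(a^*a)=p(a)^2$. A locally $C^*$-algebra $\mathcal{A}$ is a complete Hausdorff topological $*$-algebra over $\mathbb{C}$ whose topology is given by a family $\{p_\lambda\}_{\lambda\in\Lambda}$ of $C^*$-seminorms, $\Lambda$ a directed poset and $p_{\lambda_1}\le p_{\lambda_2}$ if $\lambda_1\le\lambda_2$. $M_n(\mathcal{A})$ carries the seminorms $p_\lambda^n([a_{ij}])=\|[a_{ij}+\ker p_\lambda]\|_{M_n(\mathcal{A}/\ker p_\lambda)}$, where $\mathcal{A}/\ker p_\lambda$ is a $C^*$-algebra for the norm induced by $p_\lambda$. A $*$-morphism $\pi:\mathcal{A}\to\mathcal{B}$ between locally $C^*$-algebras (seminorms $\{p_\lambda\}_{\lambda\in\Lambda}$, $\{q_\delta\}_{\delta\in\Delta}$) is local contractive if for every $\delta$ there is $\lambda$ with $q_\delta(\pi(a))\le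 p_\lambda(a)$ for all $a$, and local isometric if $\Delta=\Lambda$ and $q_\lambda(\pi(a))=p_\lambda(a)$ for all $\lambda$ and $a$. A unital local operator space is a linear subspace, containing the unit, of a unital locally $C^*$-algebra. For unital local operator spaces $\mathcal{V}\subseteq\mathcal{A}$, $\mathcal{W}\subseteq\mathcal{B}$, a linear map $\varphi:\mathcal{V}\to\mathcal{W}$ is local completely contractive if for each $\delta\in\Delta$ there is $\lambda\in\Lambda$ with $q_\delta^n([\varphi(a_{ij})])\le p_\lambda^n([a_{ij}])$ for all $n$ and all $[a_{ij}]\in M_n(\mathcal{V})$; it is local completely isometric if $\Delta=\Lambda$ and $q_\lambda^n([\varphi(a_{ij})])=p_\lambda^n([a_{ij}])$ for all $\lambda,n,[a_{ij}]$. $\mathcal{V}$ is injective if for any unital local operator space $\mathcal{W}$ and unital subspace $\mathcal{W}_0\subseteq\mathcal{W}$, every unital local completely contractive map $\mathcal{W}_0\to\mathcal{V}$ extends to a unital local completely contractive map $\mathcal{W}\to\mathcal{V}$. Quantized domain: $\mathcal{H}$ is a Hilbert space, $\Omega$ a directed poset, $\mathcal{E}=\{\mathcal{H}_\iota\}_{\iota\in\Omega}$ an upward filtered family of nonzero closed subspaces ($\mathcal{H}_{\iota_1}\subseteq\mathcal{H}_{\iota_2}$ if $\iota_1\le\iota_2$) whose union $\mathcal{D}_{\mathcal{E}}=\bigcup_\iota\mathcal{H}_\iota$ is dense in $\mathcal{H}$; $P_\iota$ is the orthogonal projection onto $\mathcal{H}_\iota$; the domain is commutative if the $P_\iota$ mutually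 commute. $C^*(\mathcal{D}_{\mathcal{E}})$ is the set of linear operators $T:\mathcal{D}_{\mathcal{E}}\to\mathcal{D}_{\mathcal{E}}$ with $P_\iota T\subseteq TP_\iota$ and $TP_\iota=P_\iota TP_\iota\in B(\mathcal{H})$ for all $\iota$; it is a unital locally $C^*$-algebra with involution $T^*=T^{\bigstar}\upharpoonright_{\mathcal{D}_{\mathcal{E}}}$ ($T^{\bigstar}$ the Hilbert space adjoint) and seminorms $\|T\|_\iota=\|T\upharpoonright_{\mathcal{H}_\iota}\|$. $\mathcal{R}$ is the commutative subring of $B(\mathcal{H})$ generated by $\{P_\iota\}_{\iota\in\Omega}\cup\{1_{\mathcal{H}}\}$. A local $\mathcal{R}$-module is a unital subspace $\mathcal{W}\subseteq C^*(\mathcal{D}_{\mathcal{E}})$ with $\mathcal{R}\mathcal{W}\subseteq\mathcal{W}$. A linear map $\varphi$ between local $\mathcal{R}$-modules is an $\mathcal{R}$-map if $\varphi(P_\iota T)=P_\iota\varphi(T)$ for all $\iota,T$. An $\mathcal{R}$-$*$-morphism is a $*$-morphism which is also an $\mathcal{R}$-map; an $\mathcal{R}$-$*$-isomorphism is a bijective one. A local $\mathcal{R}$-extension of $\mathcal{V}$ is a pair $(\mathcal{W},i)$ with $\mathcal{W}\subseteq C^*(\mathcal{D}_{\mathcal{E}})$ a local $\mathcal{R}$-module and $i:\mathcal{V}\to\mathcal{W}$ a unital local completely isometric map. A local $\mathcal{R}$-$C^*$-extension of $\mathcal{V}$ is a local $\mathcal{R}$-extension $(\mathcal{B},i)$ such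 that $\mathcal{B}$ is a unital locally $C^*$-algebra generated by $\mathcal{R}i(\mathcal{V})$; here the unit, involution and (matrix) seminorms of $\mathcal{B}$ are inherited from $C^*(\mathcal{D}_{\mathcal{E}})$, but its multiplication may differ from that of $C^*(\mathcal{D}_{\mathcal{E}})$. A local $\mathcal{R}$-$C^*$-envelope of $\mathcal{V}$ is a local $\mathcal{R}$-$C^*$-extension $(\mathcal{D},\kappa)$ of $\mathcal{V}$ with the universal property: given any local $\mathcal{R}$-$C^*$-extension $(\mathcal{C},i)$ of $\mathcal{V}$, there exists a unique unital local contractive $\mathcal{R}$-$*$-morphism $\pi:\mathcal{C}\to\mathcal{D}$ with dense range such that $\pi\circ i=\kappa$. Uniqueness in the claim means that for any two local $\mathcal{R}$-$C^*$-envelopes $(\mathcal{D}_1,\kappa_1)$, $(\mathcal{D}_2,\kappa_2)$ of $\mathcal{V}$ there is a unital local isometric $\mathcal{R}$-$*$-isomorphism $\mathcal{D}_1\to\mathcal{D}_2$. *)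

(* Defs.v *)
From HB Require Import structures.
From mathcomp Require Import all_boot all_order all_algebra.
From mathcomp Require Import all_classical all_reals all_analysis.
From mathcomp.real_closed Require Import complex.

Set Implicit Arguments.
Unset Strict Implicit.
Unset Printing Implicit Defensive.

Import Order.TTheory GRing.Theory Num.Theory.
Import numFieldNormedType.Exports.

Local Open Scope classical_set_scope.
Local Open Scope ring_scope.

Definition subsp (K : pzRingType) (V : lmodType K) (S : submodClosed V) : Type :=
  {x : V | x \in S}.

Definition to_subsp (K : pzRingType) (V : lmodType K) (S : submodClosed V) (x : V)
  (xS : x \in S) : subsp S := exist (fun x => x \in S) x xS.

Section SubspInstances.
Variables (K : pzRingType) (V : lmodType K) (S : submodClosed V).
HB.instance Definition _ := [isSub of subsp S for @sval _ _].
HB.instance Definition _ := [Choice of subsp S by <:].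
HB.instance Definition _ := [SubChoice_isSubLmodule of subsp S by <:].

Lemma submod_rpredB (x y : V) : x \in S -> y \in S -> x - y \in S.
Proof. by move=> xS yS; rewrite -scaleN1r rpredD ?rpredZ. Qed.
End SubspInstances.

Section Fullspace.
Variables (K : pzRingType) (V : lmodType K).
Definition full_pred : V -> bool := fun=> true.
Lemma full_closed : GRing.subsemimod_closed full_pred.
Proof. by split; [split|] => //. Qed.
HB.instance Definition _ := GRing.isSubmodClosed.Build K V full_pred full_closed.
Definition fullspace : submodClosed V := GRing.SubmodClosed.clone K V full_pred _.
End Fullspace.

(* Operations and seminorms only; [is_locally_Cstar] below states the axioms. *)
Record lcstar_data (R : realType) (d : Order.disp_t) (L : porderType d) :=
  LCStarData {
    lc_car :> lmodType R[i];
    lc_mul : lc_car -> lc_car -> lc_car;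
    lc_one : lc_car;
    lc_star : lc_car -> lc_car;
    lc_sn : L -> lc_car -> R }.

Arguments lc_one {R d L} l.
Arguments lc_sn {R d L l}.

(* The scaling is an explicit argument because ['M[A]_n] is not equipped by the
   library with a module structure over the scalars of the module [A]. *)
Record is_Cstar_seminorm (R : realType) (V : zmodType) (scale : R[i] -> V -> V)
    (mul : V -> V -> V) (one : V) (star : V -> V) (p : V -> R) : Prop := {
  csn_add : forall a b, p (a + b) <= p a + p b;
  csn_scale : forall c a, p (scale c a) = complex.Re `|c| * p a;
  csn_one : p one = 1;
  csn_mul : forall a b, p (mul a b) <= p a * p b;
  csn_star : forall a, p (star a) = p a;
  csn_cstar : forall a, p (mul (star a) a) = p a ^+ 2 }.

Section LocallyCstar.
Variables (R : realType) (d : Order.disp_t) (L : porderType d).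
Variable A : lcstar_data R L.

Record star_algebra_axioms : Prop := {
  lc_mulA : associative (@lc_mul _ _ _ A);
  lc_mul1l : left_id (lc_one A) (@lc_mul _ _ _ A);
  lc_mul1r : right_id (lc_one A) (@lc_mul _ _ _ A);
  lc_mulPl : forall (c : R[i]) (x y z : A),
    lc_mul (c *: x + y) z = c *: lc_mul x z + lc_mul y z;
  lc_mulPr : forall (c : R[i]) (x y z : A),
    lc_mul z (c *: x + y) = c *: lc_mul z x + lc_mul z y;
  lc_starP : forall (c : R[i]) (x y : A),
    lc_star (c *: x + y) = c^* *: lc_star x + lc_star y;
  lc_starM : forall x y : A, lc_star (lc_mul x y) = lc_mul (lc_star y) (lc_star x);
  lc_starK : involutive (@lc_star _ _ _ A) }.

Definition lc_converges (F : set_system A) (a : A) : Prop :=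
  forall (l : L) (e : R), 0 < e -> F [set b | lc_sn l (b - a) < e].

Definition lc_cauchy (F : set_system A) : Prop :=
  forall (l : L) (e : R), 0 < e -> exists a, F [set b | lc_sn l (b - a) < e].

(* Single seminorm balls form a base of neighbourhoods when [L] is directed. *)
Definition lc_closure (S : set A) : set A :=
  [set a | forall (l : L) (e : R), 0 < e -> exists2 b, S b & lc_sn l (b - a) < e].

Record is_locally_Cstar : Prop := {
  lcs_alg : star_algebra_axioms;
  lcs_inh : inhabited L;
  lcs_dir : forall l m : L, exists n, (l <= n)%O /\ (m <= n)%O;
  lcs_mono : forall l m : L, (l <= m)%O -> forall a : A, lc_sn l a <= lc_sn m a;
  lcs_sn : forall l : L, is_Cstar_seminorm *:%R (@lc_mul _ _ _ A) (lc_one A)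
                           (@lc_star _ _ _ A) (lc_sn l);
  lcs_hausdorff : forall a : A, (forall l : L, lc_sn l a = 0) -> a = 0;
  lcs_complete : forall F : set_system A,
    ProperFilter F -> lc_cauchy F -> exists a, lc_converges F a }.

Section Matrices.
Variable n : nat.

Definition mxA_scale (c : R[i]) (a : 'M[A]_n) : 'M[A]_n := map_mx ( *:%R c) a.
Definition mxA_mul (a b : 'M[A]_n) : 'M[A]_n :=
  \matrix_(i, j) \sum_k lc_mul (a i k) (b k j).
Definition mxA_one : 'M[A]_n :=
  \matrix_(i, j) if i == j then lc_one A else 0.
Definition mxA_star (a : 'M[A]_n) : 'M[A]_n := \matrix_(i, j) lc_star (a j i).

(* C*-seminorms on M_n(A) with kernel M_n(ker p_l) are the same thing as
   C*-norms on M_n(A)/M_n(ker p_l) = M_n(A/ker p_l); the latter *-algebra, being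
   a C*-algebra, has exactly one of them. *)
Definition is_mx_seminorm (l : L) (q : 'M[A]_n -> R) : Prop :=
  is_Cstar_seminorm mxA_scale mxA_mul mxA_one mxA_star q /\
  (forall a, q a = 0 <-> forall i j, lc_sn l (a i j) = 0).

End Matrices.

(* p_l^n([a_ij]) = || [a_ij + ker p_l] || in M_n(A/ker p_l), for n = m.+1. *)
Definition mx_seminorm (l : L) (m : nat) (a : 'M[A]_m.+1) : R :=
  xget 0 [set r | exists2 q, is_mx_seminorm l q & q a = r].

End LocallyCstar.

Section Morphisms.
Variable R : realType.
Variables (d : Order.disp_t) (L : porderType d).
Variables (d' : Order.disp_t) (L' : porderType d').

Definition is_star_morphism (A : lcstar_data R L) (B : lcstar_data R L')
    (f : {linear A -> B}) : Prop :=
  (forall x y, f (lc_mul x y) = lc_mul (f x) (f y)) /\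
  (forall x, f (lc_star x) = lc_star (f x)).

Definition local_contractive (A : lcstar_data R L) (B : lcstar_data R L')
    (f : {linear A -> B}) : Prop :=
  forall m : L', exists l : L, forall a, lc_sn m (f a) <= lc_sn l a.

Definition dense_range (A : lcstar_data R L) (B : lcstar_data R L')
    (f : {linear A -> B}) : Prop :=
  lc_closure (range f) = setT.

End Morphisms.

Definition local_isometric (R : realType) (d : Order.disp_t) (L : porderType d)
    (A B : lcstar_data R L) (f : {linear A -> B}) : Prop :=
  forall (l : L) a, lc_sn l (f a) = lc_sn l a.

Definition unital (R : realType) (d : Order.disp_t) (L : porderType d)
    (A : lcstar_data R L) (V : submodClosed A) : Prop := lc_one A \in V.

Section OperatorSpaces.
Variable R : realType.
Variables (d : Order.disp_t) (L : porderType d).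
Variables (d' : Order.disp_t) (L' : porderType d').

Definition unital_map (A : lcstar_data R L) (V : submodClosed A)
    (B : lcstar_data R L') (W : submodClosed B)
    (f : {linear subsp V -> subsp W}) : Prop :=
  forall v, val v = lc_one A -> val (f v) = lc_one B.

Definition local_completely_contractive
    (A : lcstar_data R L) (V : submodClosed A)
    (B : lcstar_data R L') (W : submodClosed B)
    (f : {linear subsp V -> subsp W}) : Prop :=
  forall m : L', exists l : L, forall (n : nat) (a : 'M[subsp V]_n.+1),
    mx_seminorm m (map_mx (fun v => val (f v)) a) <= mx_seminorm l (map_mx val a).

End OperatorSpaces.

Definition local_completely_isometric
    (R : realType) (d : Order.disp_t) (L : porderType d)
    (A : lcstar_data R L) (V : submodClosed A)
    (B : lcstar_data R L) (W : submodClosed B)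
    (f : {linear subsp V -> subsp W}) : Prop :=
  forall (l : L) (n : nat) (a : 'M[subsp V]_n.+1),
    mx_seminorm l (map_mx (fun v => val (f v)) a) = mx_seminorm l (map_mx val a).

Definition injective_los
    (R : realType) (d : Order.disp_t) (L : porderType d)
    (A : lcstar_data R L) (V : submodClosed A) : Prop :=
  forall (d' : Order.disp_t) (L' : porderType d') (B : lcstar_data R L')
         (W0 W : submodClosed B),
    is_locally_Cstar B -> unital W -> unital W0 -> {subset W0 <= W} ->
  forall f : {linear subsp W0 -> subsp V},
    unital_map f -> local_completely_contractive f ->
  exists g : {linear subsp W -> subsp V},
    [/\ unital_map g, local_completely_contractive g &
        forall (w0 : subsp W0) (w : subsp W), val w = val w0 -> g w = f w0].

Record hilbert (R : realType) := Hilbert {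
  hil_car :> completeNormedModType R[i];
  hil_dot : {dot hil_car for (@Num.conj R[i])};
  hil_normE : forall x, `|x| ^+ 2 = hil_dot x x }.

Record qdomain (R : realType) (d : Order.disp_t) (O : porderType d) := QDomain {
  qd_H : hilbert R;
  qd_E : O -> submodClosed qd_H;
  qd_P : O -> qd_H -> qd_H;
  qd_inh : inhabited O;
  qd_dir : forall i j : O, exists k, (i <= k)%O /\ (j <= k)%O;
  qd_closed : forall i, closed [set x | x \in qd_E i];
  qd_neq0 : forall i, exists2 x, x \in qd_E i & x != 0;
  qd_mono : forall i j, (i <= j)%O -> {subset qd_E i <= qd_E j};
  qd_dense : dense (\bigcup_i [set x | x \in qd_E i]);
  (* [qd_P i] is the orthogonal projection onto [qd_E i]: by completeness of
     [qd_E i] there is exactly one map with the next two properties *)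
  qd_P_in : forall i x, qd_P i x \in qd_E i;
  qd_P_orth : forall i x y, y \in qd_E i -> hil_dot qd_H (x - qd_P i x) y = 0 }.

Arguments qd_E {R d O} q i.
Arguments qd_P {R d O} q i x.

Definition commutative_qdomain (R : realType) (d : Order.disp_t)
    (O : porderType d) (Q : qdomain R O) : Prop :=
  forall i j x, qd_P Q i (qd_P Q j x) = qd_P Q j (qd_P Q i x).

Section Projections.
Variables (R : realType) (d : Order.disp_t) (O : porderType d) (Q : qdomain R O).
Local Notation H := (qd_H Q).
Local Notation dot := (hil_dot H).

Lemma qd_P_uniq i (x y : H) : y \in qd_E Q i ->
  (forall z, z \in qd_E Q i -> dot (x - y) z = 0) -> qd_P Q i x = y.
Proof.
move=> yE yP; apply/eqP; rewrite -subr_eq0 -normr_eq0 -sqrf_eq0.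
set w := qd_P Q i x - y; have wE : w \in qd_E Q i by rewrite submod_rpredB ?qd_P_in.
rewrite hil_normE; apply/eqP.
have {1}-> : w = (x - y) - (x - qd_P Q i x).
  by rewrite opprB [RHS]addrC addrA subrK.
by rewrite linearBl /= yP // qd_P_orth // subrr.
Qed.

Lemma qd_P_id i (x : H) : x \in qd_E Q i -> qd_P Q i x = x.
Proof. by move=> xE; apply: qd_P_uniq => // z _; rewrite subrr linear0l. Qed.

Lemma qd_P_linear i (c : R[i]) (x y : H) :
  qd_P Q i (c *: x + y) = c *: qd_P Q i x + qd_P Q i y.
Proof.
apply: qd_P_uniq; first by rewrite rpredD ?rpredZ ?qd_P_in.
move=> z zE; rewrite opprD addrACA -scalerBr linearDl linearZl_LR /=.
by rewrite !qd_P_orth // mulr0 addr0.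
Qed.

Lemma qd_PD i (x y : H) : qd_P Q i (x + y) = qd_P Q i x + qd_P Q i y.
Proof. by have := qd_P_linear i 1 x y; rewrite !scale1r. Qed.

Lemma qd_PZ i (c : R[i]) (x : H) : qd_P Q i (c *: x) = c *: qd_P Q i x.
Proof. by have := qd_P_linear i c x 0; rewrite (qd_P_id (rpred0 _)) !addr0. Qed.

Lemma qd_P_le i (x : H) : `|qd_P Q i x| <= `|x|.
Proof.
rewrite -(@ler_pXn2r _ 2) ?nnegrE //.
have oP : dot (x - qd_P Q i x) (qd_P Q i x) = 0 by rewrite qd_P_orth ?qd_P_in.
have oP' : dot (qd_P Q i x) (x - qd_P Q i x) = 0.
  by rewrite hermC /= expr0 mul1r oP rmorph0.
have -> : `|x| ^+ 2 = `|x - qd_P Q i x| ^+ 2 + `|qd_P Q i x| ^+ 2.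
  rewrite !hil_normE; have := esym (subrK (qd_P Q i x) x); move: oP oP'.
  move: (x - qd_P Q i x) => u; move: (qd_P Q i x) => v uv vu ->.
  by rewrite linearDl !linearDr /= uv vu addr0 add0r.
by rewrite lerDr exprn_ge0.
Qed.

End Projections.

Section Domain.
Variables (R : realType) (d : Order.disp_t) (O : porderType d) (Q : qdomain R O).
Local Notation H := (qd_H Q).

Definition qdom_pred : H -> bool := fun x => `[< exists i, x \in qd_E Q i >].

Lemma qdom_closed : GRing.subsemimod_closed qdom_pred.
Proof.
split; [split|].
- by case: (qd_inh Q) => i; apply/asboolP; exists i; rewrite rpred0.
- move=> x y /asboolP[i xi] /asboolP[j yj]; apply/asboolP.
  have [k [ik jk]] := qd_dir Q i j.
  by exists k; rewrite rpredD // ?(qd_mono ik xi) ?(qd_mono jk yj).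
- by move=> c x /asboolP[i xi]; apply/asboolP; exists i; rewrite rpredZ.
Qed.

HB.instance Definition _ := GRing.isSubmodClosed.Build R[i] H qdom_pred qdom_closed.

Definition qdom : submodClosed H := GRing.SubmodClosed.clone R[i] H qdom_pred _.

Definition dom : Type := subsp qdom.
HB.instance Definition _ := GRing.Lmodule.on dom.

Lemma qd_P_dom i x : qd_P Q i x \in qdom.
Proof. by apply/asboolP; exists i; exact: qd_P_in. Qed.

Definition PD (i : O) (x : H) : dom := to_subsp (qd_P_dom i x).

(* [fun x : H => val (T (PD i x))] is the operator T P_i, defined on all of H.
   The domain of P_i T is D_E, hence the different types of [x] in [cso_left]
   (P_i T is contained in T P_i) and [cso_right] (T P_i = P_i T P_i). *)
Record cstar_op (T : dom -> dom) : Prop := {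
  cso_linear : forall (c : R[i]) x y, T (c *: x + y) = c *: T x + T y;
  cso_left : forall i (x : dom), qd_P Q i (val (T x)) = val (T (PD i (val x)));
  cso_right : forall i (x : H), val (T (PD i x)) = qd_P Q i (val (T (PD i x)));
  cso_bounded : forall i, exists M : R[i],
    forall x : H, `|val (T (PD i x))| <= M * `|x| }.

Definition cstar_pred : (dom -> dom) -> bool := fun T => `[< cstar_op T >].

Lemma cstar_closed : GRing.subsemimod_closed cstar_pred.
Proof.
split; [split|].
- apply/asboolP; split=> [c x y|i x|i x|i].
  + by rewrite scaler0 addr0.
  + by rewrite /= qd_P_id ?rpred0.
  + by rewrite /= qd_P_id ?rpred0.
  + by exists 0 => x; rewrite /= normr0 mul0r.
- move=> S T /asboolP[Sl SP SP' Sb] /asboolP[Tl TP TP' Tb].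
  have E x : (S + T) x = S x + T x by [].
  have EV x : val ((S + T) x) = val (S x) + val (T x) by [].
  apply/asboolP; split=> [c x y|i x|i x|i].
  + by rewrite !E Sl Tl scalerDr addrACA.
  + by rewrite !EV qd_PD SP TP.
  + by rewrite !EV qd_PD -SP' -TP'.
  + have [M HM] := Sb i; have [N HN] := Tb i; exists (M + N) => x.
    by rewrite !EV mulrDl (le_trans (ler_normD _ _)) // lerD ?HM ?HN.
- move=> a T /asboolP[Tl TP TP' Tb].
  have E x : (a *: T) x = a *: T x by [].
  have EV x : val ((a *: T) x) = a *: val (T x) by [].
  apply/asboolP; split=> [c x y|i x|i x|i].
  + by rewrite !E Tl scalerDr !scalerA mulrC.
  + by rewrite !EV qd_PZ TP.
  + by rewrite !EV qd_PZ -TP'.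
  + have [M HM] := Tb i; exists (`|a| * M) => x.
    by rewrite !EV normrZ -mulrA ler_wpM2l ?HM.
Qed.

HB.instance Definition _ :=
  GRing.isSubmodClosed.Build R[i] (dom -> dom) cstar_pred cstar_closed.

Definition cstar_sub : submodClosed (dom -> dom) :=
  GRing.SubmodClosed.clone R[i] (dom -> dom) cstar_pred _.

Definition cstar_type : Type := subsp cstar_sub.
HB.instance Definition _ := GRing.Lmodule.on cstar_type.

Definition opval (T : cstar_type) (x : dom) : H := val (val T x).

Lemma cstar_one_subproof : (fun x : dom => x) \in cstar_sub.
Proof.
apply/asboolP; split=> // i.
- by move=> x; rewrite /= [RHS]qd_P_id ?qd_P_in.
- by exists 1 => x; rewrite mul1r qd_P_le.
Qed.

Lemma cstar_mul_subproof (S T : cstar_type) :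
  (fun x => val S (val T x)) \in cstar_sub.
Proof.
have /asboolP[Sl SP SP' Sb] := valP S; have /asboolP[Tl TP TP' Tb] := valP T.
have TPD i x : val T (PD i x) = PD i (val (val T (PD i x))) by exact: val_inj.
apply/asboolP; split=> [c x y|i x|i x|i].
- by rewrite Tl Sl.
- rewrite SP; congr (val (val S _)); apply: val_inj; exact: TP.
- by rewrite [in LHS]TPD SP' -TPD.
- have [M HM] := Sb i; have [N HN] := Tb i; exists (`|M| * N) => x.
  rewrite TPD; set y := val (val T (PD i x)).
  apply: (@le_trans _ _ (`|M| * `|y|)).
    rewrite -(normr_id y) -normrM ger0_norm ?HM //.
    exact: le_trans (normr_ge0 _) (HM y).
  by rewrite -mulrA ler_wpM2l ?HN.
Qed.

Definition cstar_one : cstar_type := to_subsp cstar_one_subproof.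

Definition cstar_mul (S T : cstar_type) : cstar_type :=
  to_subsp (cstar_mul_subproof S T).

(* If [x |-> <T x, y>] is represented by a vector for each [y] in D_E, then D_E
   lies in the domain of the Hilbert space adjoint of [T], and [S] is the
   restriction of that adjoint to D_E; it exists by Riesz on each [qd_E i] and
   is unique by density of D_E. *)
Definition is_adjoint (T S : cstar_type) : Prop :=
  forall x y : dom,
    hil_dot H (opval T x) (val y) = hil_dot H (val x) (opval S y).

Definition cstar_star (T : cstar_type) : cstar_type := xget 0 (is_adjoint T).

Definition cstar_sn (i : O) (T : cstar_type) : R :=
  sup [set complex.Re `|opval T x| |
         x in [set x : dom | val x \in qd_E Q i /\ `|val x| <= 1]].

Definition cstar : lcstar_data R O :=
  LCStarData cstar_mul cstar_one cstar_star cstar_sn.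

End Domain.

Section RModules.
Variables (R : realType) (d : Order.disp_t) (O : porderType d) (Q : qdomain R O).
Local Notation H := (qd_H Q).

Inductive proj_ring : (H -> H) -> Prop :=
| proj_ring1 : proj_ring idfun
| proj_ringP i : proj_ring (qd_P Q i)
| proj_ringB r s : proj_ring r -> proj_ring s -> proj_ring (fun x => r x - s x)
| proj_ringM r s : proj_ring r -> proj_ring s -> proj_ring (r \o s).

(* [S = r T], with [r] acting on all of H and [S], [T] on D_E. *)
Definition is_lmul (r : H -> H) (T S : cstar Q) : Prop :=
  forall x, opval S x = r (opval T x).

Record local_Rmodule (W : submodClosed (cstar Q)) : Prop := {
  lrm_unital : unital W;
  lrm_mul : forall r T, proj_ring r -> T \in W ->
    exists2 S, S \in W & is_lmul r T S }.

Definition is_Rmap (W1 W2 : submodClosed (cstar Q))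
    (f : {linear subsp W1 -> subsp W2}) : Prop :=
  forall i T S, is_lmul (qd_P Q i) (val T) (val S) ->
    is_lmul (qd_P Q i) (val (f T)) (val (f S)).

(* The unit, involution and seminorms of [rs_alg] are those of C*(D_E); the
   multiplication [rs_mul] need not be. *)
Record Rstar_module := RStarModule {
  rs_sp : submodClosed (cstar Q);
  rs_mod : local_Rmodule rs_sp;
  rs_star : forall T, T \in rs_sp -> lc_star T \in rs_sp;
  rs_mul : subsp rs_sp -> subsp rs_sp -> subsp rs_sp }.

Definition rs_alg (B : Rstar_module) : lcstar_data R O :=
  @LCStarData R d O (subsp (rs_sp B)) (@rs_mul B)
    (to_subsp (lrm_unital (rs_mod B)))
    (fun T => to_subsp (rs_star (valP T)))
    (fun i T => lc_sn i (val T)).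

Record is_local_RCstar_algebra (B : Rstar_module) : Prop := {
  rca_lcs : is_locally_Cstar (rs_alg B);
  rca_mx : forall (i : O) (n : nat) (a : 'M[rs_alg B]_n.+1),
    mx_seminorm i a = mx_seminorm i (map_mx val a) }.

Definition generated_by (A : lcstar_data R O) (S : set A) : Prop :=
  forall C : submodClosed A, S `<=` [set x | x \in C] ->
    (forall x y, x \in C -> y \in C -> lc_mul x y \in C) ->
    (forall x, x \in C -> lc_star x \in C) ->
    lc_closure [set x | x \in C] `<=` [set x | x \in C] ->
  forall x, x \in C.

Variable V : submodClosed (cstar Q).

Record is_RCstar_extension (B : Rstar_module)
    (i : {linear subsp V -> subsp (rs_sp B)}) : Prop := {
  rce_alg : is_local_RCstar_algebra B;
  rce_unital : unital_map i;
  rce_isometric : local_completely_isometric i;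
  rce_generated : @generated_by (rs_alg B)
    [set b | exists r v, proj_ring r /\ is_lmul r (val (i v)) (val b)] }.

Record is_RCstar_morphism (B1 B2 : Rstar_module)
    (f : {linear rs_alg B1 -> rs_alg B2}) : Prop := {
  rcm_star : is_star_morphism f;
  rcm_unital : f (lc_one (rs_alg B1)) = lc_one (rs_alg B2);
  rcm_Rmap : @is_Rmap (rs_sp B1) (rs_sp B2) f }.

Record is_RCstar_envelope (D : Rstar_module)
    (k : {linear subsp V -> subsp (rs_sp D)}) : Prop := {
  env_ext : is_RCstar_extension k;
  env_univ : forall (C : Rstar_module) (i : {linear subsp V -> subsp (rs_sp C)}),
    is_RCstar_extension i ->
    let good (f : {linear rs_alg C -> rs_alg D}) :=
      [/\ is_RCstar_morphism f, local_contractive f, dense_range f &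
          forall v, f (i v) = k v] in
    (exists f, good f) /\ (forall f g, good f -> good g -> f =1 g) }.

End RModules.

(* Main.v *)
(** The universal property yields morphisms between the two envelopes in both
    directions, and its uniqueness clause makes them mutually inverse.  Being
    local contractive only compares seminorms with different indices; but the
    compression [T |-> P_i T] satisfies [p_l (P_i T) <= p_i T] for every [l] and
    [p_i (P_i T) = p_i T], so an [R]-map [f] that is local contractive satisfies
    [p_i (f T) = p_i (f (P_i T)) <= p_l (P_i T) <= p_i T].  Applied to both
    directions this gives the isometry. *)
Require Import Defs.
From mathcomp Require Import all_boot all_order all_algebra.
From mathcomp Require Import all_classical all_reals all_analysis.
From mathcomp.real_closed Require Import complex.

Set Implicit Arguments.
Unset Strict Implicit.
Unset Printing Implicit Defensive.

Import Order.TTheory GRing.Theory Num.Theory.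

Local Open Scope classical_set_scope.
Local Open Scope ring_scope.

Section Seminorms.
Variables (R : realType) (d : Order.disp_t) (O : porderType d) (Q : qdomain R O).

Lemma le_Re (x y : R[i]) : x <= y -> complex.Re x <= complex.Re y.
Proof. by rewrite lecE => /andP[]. Qed.

Lemma opval_comm_P (T : cstar Q) i (x : dom Q) :
  qd_P Q i (opval T x) = opval T (PD i (val x)).
Proof. by have /asboolP[_ + _ _] := valP T; apply. Qed.

Lemma PD_id i (x : dom Q) : val x \in qd_E Q i -> PD i (val x) = x.
Proof. by move=> xi; apply: val_inj; rewrite /= qd_P_id. Qed.

Lemma cstar_sn_ubound (T : cstar Q) i (x : dom Q) :
  val x \in qd_E Q i -> `|val x| <= 1 ->
  complex.Re `|opval T x| <= cstar_sn i T.
Proof.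
move=> xi x1; apply: ub_le_sup; last by exists x.
have /asboolP[_ _ _ /(_ i)[M HM]] := valP T.
exists (complex.Re `|M|) => _ [y [yi y1] <-]; apply: le_Re.
have := HM (val y); rewrite PD_id // => /le_trans; apply.
(* [M] is only known to be complex, but [M * |y|] dominates a norm, so it is nonnegative and equals
   [|M| * |y|], which is at most [|M|]. *)
have := HM (val y) => /(le_trans (normr_ge0 _)) M0.
by rewrite -(ger0_norm M0) normrM normr_id ler_piMr.
Qed.

Lemma cstar_sn_le (T : cstar Q) i (c : R) :
  (forall x : dom Q, val x \in qd_E Q i -> `|val x| <= 1 ->
     complex.Re `|opval T x| <= c) ->
  cstar_sn i T <= c.
Proof.
move=> Tc; apply: ge_sup; last by move=> _ [x [xi x1] <-]; exact: Tc.
(* The zero vector makes the set nonempty; the supremum of an empty set would be the default 0,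
   which [c] need not dominate. *)
exists (complex.Re `|opval T 0|), 0 => //; split; first by rewrite rpred0.
by rewrite normr0.
Qed.

(** Since P_i T = T P_i on the domain and P_i maps the unit ball into that of H_i, [S] only sees the
    values of [T] there, whatever [l] is. *)
Lemma cstar_sn_compress_le i l (T S : cstar Q) :
  is_lmul (qd_P Q i) T S -> cstar_sn l S <= cstar_sn i T.
Proof.
move=> TS; apply: cstar_sn_le => x _ x1; rewrite TS opval_comm_P.
by apply: cstar_sn_ubound; rewrite /= ?qd_P_in // (le_trans (qd_P_le _ _)).
Qed.

(** On H_i the projection is the identity, so T x = T P_i x = P_i T x and both operators agree
    there. *)
Lemma cstar_sn_compress i (T S : cstar Q) :
  is_lmul (qd_P Q i) T S -> cstar_sn i T <= cstar_sn i S.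
Proof.
move=> TS; apply: cstar_sn_le => x xi x1.
by rewrite -[x in opval T x](PD_id xi) -opval_comm_P -TS; exact: cstar_sn_ubound.
Qed.

End Seminorms.

Section Morphisms.
Variables (R : realType) (d : Order.disp_t) (O : porderType d) (Q : qdomain R O).

Lemma Rmap_contractive (B1 B2 : Rstar_module Q)
    (f : {linear rs_alg B1 -> rs_alg B2}) :
  @is_Rmap _ _ _ Q (rs_sp B1) (rs_sp B2) f -> local_contractive f ->
  forall i a, lc_sn i (f a) <= lc_sn i a.
Proof.
move=> fR fc i a.
(* The compression is a product of operators, not one for [rs_mul]; it stays in [B1] by the module
   property. *)
have [S SB aS] := lrm_mul (rs_mod B1) (proj_ringP Q i) (valP a).
have [l fl] := fc i.
have faS := fR i a (to_subsp SB) aS.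
apply: le_trans (cstar_sn_compress faS) _.
apply: le_trans (fl (to_subsp SB)) _; exact: cstar_sn_compress_le aS.
Qed.

Lemma comp_RCstar_morphism (B1 B2 B3 : Rstar_module Q)
    (f : {linear rs_alg B1 -> rs_alg B2}) (g : {linear rs_alg B2 -> rs_alg B3}) :
  is_RCstar_morphism f -> is_RCstar_morphism g -> is_RCstar_morphism (g \o f).
Proof.
move=> [[fM fS] f1 fR] [[gM gS] g1 gR]; split.
- by split=> [x y|x] /=; [rewrite fM gM|rewrite fS gS].
- by rewrite /= f1 g1.
- by move=> i T S TS; apply: gR; exact: fR.
Qed.

Lemma id_RCstar_morphism (B : Rstar_module Q) :
  is_RCstar_morphism (idfun : {linear rs_alg B -> rs_alg B}).
Proof. by split. Qed.

End Morphisms.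

Section LocalMaps.
Variables (R : realType) (d : Order.disp_t) (L : porderType d).

Lemma comp_local_contractive (A B C : lcstar_data R L)
    (f : {linear A -> B}) (g : {linear B -> C}) :
  local_contractive f -> local_contractive g -> local_contractive (g \o f).
Proof.
move=> fc gc m; have [l gl] := gc m; have [k fk] := fc l.
by exists k => a; apply: le_trans (gl _) (fk _).
Qed.

Lemma comp_dense_range (A B C : lcstar_data R L)
    (f : {linear A -> B}) (g : {linear B -> C}) :
  is_locally_Cstar C -> local_contractive g ->
  dense_range f -> dense_range g -> dense_range (g \o f).
Proof.
move=> Cstar gc fd gd; apply/seteqP; split=> // c _ m e e0.
have e2 : 0 < e / 2 by rewrite divr_gt0.
have : lc_closure (range g) c by rewrite gd.
move=> /(_ m _ e2)[_ [b _ <-] bc]; have [l gl] := gc m.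
(* [b] is approximated in the seminorm [l] that controls [m] through [g], so [l] must be chosen
   first. *)
have : lc_closure (range f) b by rewrite fd.
move=> /(_ l _ e2)[_ [a _ <-] ab]; exists (g (f a)); first by exists a.
have -> : g (f a) - c = g (f a - b) + (g b - c) by rewrite linearB addrA subrK.
apply: le_lt_trans (csn_add (lcs_sn Cstar m) _ _) _.
by rewrite (splitr e) ltrD // (le_lt_trans (gl _)).
Qed.

Lemma id_dense_range (A : lcstar_data R L) :
  is_locally_Cstar A -> dense_range (idfun : {linear A -> A}).
Proof.
move=> Astar; apply/seteqP; split=> // a _ m e e0; exists a; first by exists a.
(* Homogeneity at the scalar 0 gives that the seminorm vanishes at 0. *)
have := csn_scale (lcs_sn Astar m) 0 0.
by rewrite scale0r normr0 mul0r subrr => ->.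
Qed.

End LocalMaps.

Section Envelopes.
Variables (R : realType) (d : Order.disp_t) (O : porderType d) (Q : qdomain R O).
Variable V : submodClosed (cstar Q).

(** An envelope is an extension of itself, so its universal property makes [f] and the identity the
    same morphism. *)
Lemma envelope_endo_id (D : Rstar_module Q)
    (k : {linear subsp V -> subsp (rs_sp D)}) (f : {linear rs_alg D -> rs_alg D}) :
  is_RCstar_envelope k -> is_RCstar_morphism f -> local_contractive f ->
  dense_range f -> (forall v, f (k v) = k v) -> f =1 id.
Proof.
move=> kenv fm fc fd fk; have [_ uniq_f] := env_univ kenv (env_ext kenv).
apply: (uniq_f f (idfun : {linear rs_alg D -> rs_alg D})); split=> //.
- exact: id_RCstar_morphism.
- by move=> m; exists m.
- exact: id_dense_range (rca_lcs (rce_alg (env_ext kenv))).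
Qed.

End Envelopes.

Theorem corollary4p16 (R : realType) (d : Order.disp_t) (O : porderType d)
    (Q : qdomain R O) (hcomm : commutative_qdomain Q)
    (hinj : injective_los (fullspace (cstar Q)))
    (V : submodClosed (cstar Q)) (hV : unital V)
    (D1 : Rstar_module Q) (k1 : {linear subsp V -> subsp (rs_sp D1)})
    (h1 : is_RCstar_envelope k1)
    (D2 : Rstar_module Q) (k2 : {linear subsp V -> subsp (rs_sp D2)})
    (h2 : is_RCstar_envelope k2) :
  exists f : {linear rs_alg D1 -> rs_alg D2},
    [/\ is_RCstar_morphism f, bijective f & local_isometric f].
Proof.
have [[f [fm fc fd fk]] _] := env_univ h2 (env_ext h1).
have [[g [gm gc gd gk]] _] := env_univ h1 (env_ext h2).
have fK : cancel f g.
  apply: (envelope_endo_id (f := g \o f) h1).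
  - exact: comp_RCstar_morphism.
  - exact: comp_local_contractive.
  - exact: comp_dense_range (rca_lcs (rce_alg (env_ext h1))) _ _ _.
  - by move=> v; rewrite /= fk gk.
have gK : cancel g f.
  apply: (envelope_endo_id (f := f \o g) h2).
  - exact: comp_RCstar_morphism.
  - exact: comp_local_contractive.
  - exact: comp_dense_range (rca_lcs (rce_alg (env_ext h2))) _ _ _.
  - by move=> v; rewrite /= gk fk.
exists f; split=> //; first by exists g.
move=> i a; apply: le_anti; rewrite (Rmap_contractive (rcm_Rmap fm) fc) /=.
(* The reverse inequality is contractivity of [g] at [f a]. *)
by rewrite -{1}(fK a) (Rmap_contractive (rcm_Rmap gm) gc).
Qed.
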